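(* Let $k\ge 3$ be an integer, let $\lambda\in\mathbb{R}$ with $\lambda\ne 0$, and let $$f_\lambda(x,y)=x^{2k}+\binom{2k}{k}\lambda\,x^ky^k+y^{2k}.$$ Then $L_{\mathbb{R}}(f_\lambda)\in\{2k-2,\,2k-1\}$.
   Context: For a field $K\subseteq\mathbb{C}$ and a binary form (homogeneous polynomial in $x,y$) $f\in K[x,y]$ of degree $d$, the $K$-rank $L_K(f)$ is the smallest $r$ for which there exist $\lambda_j,\alpha_j,\beta_j\in K$ with $f(x,y)=\sum_{j=1}^r\lambda_j(\alpha_jx+\beta_jy)^d$. For $K=\mathbb{R}$ it is called the real Waring rank. *)

(* Defs.v *)
From mathcomp Require Import all_boot all_order all_algebra.
From mathcomp Require Import mpoly.

Set Implicit Arguments.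
Unset Strict Implicit.
Unset Printing Implicit Defensive.

Import GRing.Theory.
Local Open Scope ring_scope.

Definition varx (K : fieldType) : {mpoly K[2]} := 'X_(@ord0 1).
Definition vary (K : fieldType) : {mpoly K[2]} := 'X_(@ord_max 1).

(* The degree d is explicit because it cannot be recovered from the zero
   form; r = 0 is allowed and gives exactly the zero form. *)
Definition power_sum_rep (K : fieldType) (d : nat) (f : {mpoly K[2]})
    (r : nat) : Prop :=
  exists lam alpha beta : 'I_r -> K,
    f = \sum_(j < r)
          lam j *: (alpha j *: varx K + beta j *: vary K) ^+ d.

(* The K-rank as a relation: r is the K-rank L_K(f) of the form f of
   degree d.  At most one r satisfies it. *)
Definition is_rank (K : fieldType) (d : nat) (f : {mpoly K[2]})
    (r : nat) : Prop :=
  power_sum_rep d f r /\ forall s : nat, power_sum_rep d f s -> (r <= s)%N.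

Definition flambda (K : fieldType) (k : nat) (lambda : K) : {mpoly K[2]} :=
  varx K ^+ (2 * k)
  + ('C(2 * k, k)%:R * lambda) *: (varx K ^+ k * vary K ^+ k)
  + vary K ^+ (2 * k).

Lemma flambda_homog (K : fieldType) (k : nat) (lambda : K) :
  flambda k lambda \is (2 * k).-homog.
Proof.
have hX (i : 'I_2) n : ('X_i : {mpoly K[2]}) ^+ n \is n.-homog.
  by rewrite -[n in n.-homog]mul1n; apply: dhomogMn; rewrite dhomogX /= mdeg1.
rewrite !rpredD ?hX //; apply: rpredZ.
by rewrite mul2n -addnn; apply: dhomogM; apply: hX.
Qed.

(* Main.v *)
(* Write a_0 = 1, a_k = lambda, a_(2k) = 1 and a_m = 0 otherwise, so that
   f_lambda = sum_m C(2k,m) a_m x^(2k-m) y^m; a representation of f_lambda is a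
   solution of sum_j l_j alpha_j^(2k-m) beta_j^m = a_m.

   Lower bound (Sylvester): let h be the monic polynomial whose roots are the
   distinct slopes beta_j / alpha_j of a representation of length at most
   2k - 3.  Pairing h with the moments forces the coefficients of degree k - 1
   and k - 2 of h to vanish (or contradicts h being monic), whereas by Rolle a
   polynomial with simple real roots has no two consecutive zero coefficients.

   Upper bound: it suffices to find a monic h of degree 2k - 1 with simple real
   roots such that h_0 = - lambda h_k and lambda h_(k-1) = -1.  After rescaling
   the variable, only lambda^2 h_k h_(k-1) = h_0 and - h_0 / (lambda h_k) > 0 are
   needed.  Take h = (X - s) q; when q has the sign pattern and the root location
   of [good_roots] below, the intermediate value theorem provides s between 0
   and q_(k-1) / q_k, an interval free of roots of q.  Such a q is explicit for
   k = 3, and (X + e)(X + 1/e) q with e > 0 small serves for k + 1. *)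

Require Import Defs.
From mathcomp Require Import all_boot all_order all_algebra.
From mathcomp Require Import reals.
From mathcomp Require Import mpoly.
From mathcomp Require Import polyrcf ring lra zify.
From mathcomp Require boolp.

Import Order.TTheory GRing.Theory Num.Theory.

Local Open Scope ring_scope.

(** * Rolle's theorem and gaps in polynomials with simple real roots *)

Definition simple_real_rooted {R : rcfType} (p : {poly R}) : Prop :=
  exists rs : seq R, [/\ uniq rs, all (root p) rs & size p = (size rs).+1].

(** Each gap between consecutive roots yields a root of the derivative. Starting the path at [x]
    keeps the new roots strictly ordered, hence distinct. *)
Lemma rolle_path {R : rcfType} (p : {poly R}) (x : R) (rs : seq R) :
  path <%R x rs -> all (root p) (x :: rs) ->
  exists ss, [/\ size ss = size rs, all (root p^`()) ss & path <%R x ss].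
Proof.
elim: rs x => [|y rs IH] x /=; first by exists [::].
case/andP=> xy pth /and3P[px py prs].
have [ss [szs rss ps]] := IH y pth (introT andP (conj py prs)).
have [|c cxy c0] := poly_rolle (p := p) xy.
  by rewrite (eqP px) (eqP py).
move: cxy; rewrite in_itv /= => /andP[xc cy].
exists (c :: ss); split => /=; first by rewrite szs.
  by rewrite /root c0 eqxx.
rewrite xc; case: ss ps {szs rss} => //= z ss /andP[yz ->].
by rewrite (lt_trans cy yz).
Qed.

Lemma simple_real_rooted_deriv {R : rcfType} (p : {poly R}) :
  (1 < size p)%N -> simple_real_rooted p -> simple_real_rooted p^`().
Proof.
move=> p1 [rs [urs rrs szp]].
have: sorted <%R (sort <=%R rs) by rewrite lt_sorted_uniq_le sort_uniq urs sort_le_sorted.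
have: all (root p) (sort <=%R rs) by rewrite all_sort.
have: size (sort <=%R rs) = size rs by rewrite size_sort.
case: (sort <=%R rs) => [|x ss] /= szs; first by move: p1; rewrite szp -szs.
move=> rss srt.
have [ts [szt rts pt]] := rolle_path p x ss srt rss.
exists ts; split => //.
  by move/path_sorted: pt; rewrite lt_sorted_uniq_le => /andP[].
by rewrite polyorder.size_deriv szp -szs szt.
Qed.

Lemma simple_real_rooted_derivn {R : rcfType} (p : {poly R}) (m : nat) :
  (m < size p)%N -> simple_real_rooted p ->
  simple_real_rooted p^`(m) /\ size p^`(m) = (size p - m)%N.
Proof.
elim: m => [|m IH] mp sp; first by rewrite derivn0 subn0.
have [sm szm] := IH (ltnW mp) sp.
rewrite derivnS polyorder.size_deriv szm; split; last by rewrite subnS.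
by apply: simple_real_rooted_deriv; rewrite // szm ltn_subRL addn1.
Qed.

(** ['X^2] would divide [p], and the quotient, two degrees lower, would keep all nonzero roots, of
    which there are at least [size rs - 1]. *)
Lemma simple_real_rooted_nosquare {R : rcfType} (p : {poly R}) :
  simple_real_rooted p -> p`_0 = 0 -> p`_1 = 0 -> False.
Proof.
move=> [rs [urs rrs szp]] p0 p1.
have p_neq0 : p != 0 by rewrite -size_poly_eq0 szp.
have pE : p = drop_poly 2 p * 'X^2.
  rewrite -[LHS](poly_take_drop 2); rewrite (_ : take_poly 2 p = 0) ?add0r //.
  apply/polyP => i; rewrite coef_take_poly coef0.
  by case: i => [|[|i]].
have dp_neq0 : drop_poly 2 p != 0.
  by apply: contraNneq p_neq0 => d0; rewrite pE d0 mul0r.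
have := max_poly_roots dp_neq0 (rs := rem 0 rs).
rewrite size_drop_poly szp rem_uniq // => /(_ _ isT) H.
have /H : all (root (drop_poly 2 p)) (rem 0 rs).
  apply/allP => z; rewrite mem_rem_uniq // inE => /andP[z0 zrs].
  have := allP rrs z zrs; rewrite {1}pE rootM => /orP[//|].
  by move/rootP/eqP; rewrite hornerXn expf_eq0 /= (negPf z0).
have : (size rs <= (size (rem (0%R : R) rs)).+1)%N.
  case: (boolP ((0 : R) \in rs)) => h; first by rewrite size_rem // prednK //; case: (rs) h.
  by rewrite rem_id.
by move=> h1 h2; have := leq_trans h1 h2; lia.
Qed.

(** Differentiating [m] times preserves simple real roots and moves the gap down to degrees 0 and
    1. *)
Lemma simple_real_rooted_nogap {R : rcfType} (p : {poly R}) (m : nat) :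
  (m < size p)%N -> simple_real_rooted p -> p`_m = 0 -> p`_m.+1 = 0 -> False.
Proof.
move=> mp sp pm pm1.
have [sm _] := simple_real_rooted_derivn p m mp sp.
apply: (simple_real_rooted_nosquare _ sm); rewrite coef_derivn.
  by rewrite addn0 pm mul0rn.
by rewrite addn1 pm1 mul0rn.
Qed.

(** * Power sums and moments *)

(* The coefficient of [x^(2k-m) y^m] in [flambda k lam], divided by ['C(2k, m)]. *)
Definition moment {R : nzRingType} (k : nat) (lam : R) (m : nat) : R :=
  (m == 0)%:R + lam * (m == k)%:R + (m == 2 * k)%N%:R.

Lemma flambdaE {R : fieldType} (k : nat) (lam : R) : (0 < k)%N ->
  flambda k lam = \sum_(i < (2 * k).+1)
    ('C(2 * k, i)%:R * moment k lam i) *: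
      (varx R ^+ (2 * k - i) * vary R ^+ i).
Proof.
move=> k0.
pose F i : {mpoly R[2]} := varx R ^+ (2 * k - i) * vary R ^+ i.
have delta (j : nat) (c : R) : (j < (2 * k).+1)%N ->
    \sum_(i < (2 * k).+1) ('C(2 * k, i)%:R * (c * (i == j :> nat)%:R)) *: F i
    = ('C(2 * k, j)%:R * c) *: F j.
  move=> jk; rewrite (bigD1 (Ordinal jk)) //= eqxx mulr1 big1 ?addr0 // => i.
  by rewrite -val_eqE /= => /negPf ->; rewrite !mulr0 scale0r.
rewrite (eq_bigr (fun i : 'I__ =>
    ('C(2 * k, i)%:R * (1 * (i == 0 :> nat)%:R)) *: F i
    + ('C(2 * k, i)%:R * (lam * (i == k :> nat)%:R)) *: F i
    + ('C(2 * k, i)%:R * (1 * (i == 2 * k :> nat)%N%:R)) *: F i)); last first.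
  by move=> i _; rewrite /moment !mul1r !mulrDr !scalerDl.
rewrite !big_split /= !delta //; last by lia.
rewrite /F /flambda bin0 binn !mulr1 !scale1r subn0 subnn (_ : (2 * k - k)%N = k); last by lia.
by rewrite mul1r.
Qed.

Lemma power_sumE {R : fieldType} (n s : nat) (lam alpha beta : 'I_s -> R) :
  \sum_(j < s) lam j *: (alpha j *: varx R + beta j *: vary R) ^+ n =
  \sum_(i < n.+1)
    ('C(n, i)%:R * \sum_(j < s) lam j * alpha j ^+ (n - i) * beta j ^+ i) *:
      (varx R ^+ (n - i) * vary R ^+ i).
Proof.
under eq_bigr do rewrite exprDn scaler_sumr.
rewrite exchange_big /=; apply: eq_bigr => i _.
rewrite mulr_sumr scaler_suml; apply: eq_bigr => j _.
rewrite !exprZn -scalerAl -scalerAr scalerA -scaler_nat !scalerA.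
by congr (_ *: _); ring.
Qed.

(** Dehomogenizing, with x sent to 1 and y to ['X], turns both sides into univariate polynomials. *)
Lemma binary_form_coef_inj {R : fieldType} (n : nat) (c d : nat -> R) :
  \sum_(i < n.+1) c i *: (varx R ^+ (n - i) * vary R ^+ i) =
  \sum_(i < n.+1) d i *: (varx R ^+ (n - i) * vary R ^+ i) ->
  forall i, (i <= n)%N -> c i = d i.
Proof.
pose h (i : 'I_2) : {poly R} := if i == ord0 then 1 else 'X.
pose phi (p : {mpoly R[2]}) : {poly R} := mmap polyC h p.
have phiE (e : nat -> R) :
    phi (\sum_(i < n.+1) e i *: (varx R ^+ (n - i) * vary R ^+ i))
    = \poly_(i < n.+1) e i.
  rewrite /phi raddf_sum poly_def /=; apply: eq_bigr => i _.
  rewrite mmapZ rmorphM !rmorphXn /= /varx /vary !mmapX !mmap1U /h /=.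
  by rewrite expr1n mul1r mul_polyC.
move=> /(congr1 phi); rewrite !phiE => E i ni.
by have := congr1 (fun p : {poly R} => p`_i) E; rewrite !coef_poly ltnS ni.
Qed.

(** Coefficients are compared one by one; the binomials cancel because the characteristic is
    zero. *)
Lemma power_sum_repP {R : numFieldType} (k s : nat) (lam : R) : (0 < k)%N ->
  power_sum_rep (2 * k) (flambda k lam) s <->
  exists l alpha beta : 'I_s -> R, forall m, (m <= 2 * k)%N ->
    \sum_(j < s) l j * alpha j ^+ (2 * k - m) * beta j ^+ m = moment k lam m.
Proof.
move=> k0; split=> -[l [alpha [beta E]]]; exists l, alpha, beta.
  move=> m mk; move: E; rewrite flambdaE // power_sumE.
  move=> /(binary_form_coef_inj _ (fun i => 'C(2 * k, i)%:R * moment k lam i)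
    (fun i => 'C(2 * k, i)%:R *
      \sum_(j < s) l j * alpha j ^+ (2 * k - i) * beta j ^+ i)).
  move=> /(_ m mk) /mulfI -> //.
  by rewrite pnatr_eq0 -lt0n bin_gt0.
rewrite flambdaE // power_sumE; apply: eq_bigr => i _.
by rewrite E // -ltnS.
Qed.

(** * The lower bound *)

(** After exchanging sums, each term with [alpha j != 0] carries the factor [h.[beta j / alpha j] =
    0]. Terms with [alpha j = 0] vanish since [n + i < 2 * k] keeps the exponent of [alpha j]
    positive. *)
Lemma apolar_moments {R : fieldType} (k s n i : nat) (lam : R)
    (l alpha beta : 'I_s -> R) (h : {poly R}) :
  (forall m, (m <= 2 * k)%N ->
    \sum_(j < s) l j * alpha j ^+ (2 * k - m) * beta j ^+ m
      = moment k lam m) ->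
  (size h <= n.+1)%N -> (n + i < 2 * k)%N ->
  (forall j, alpha j != 0 -> root h (beta j / alpha j)) ->
  \sum_(t < n.+1) h`_t * moment k lam (t + i) = 0.
Proof.
move=> mom szh nik rh.
have le_tik (t : 'I_n.+1) : (t + i <= 2 * k)%N by have := ltn_ord t; lia.
under eq_bigr => t _ do rewrite -mom // mulr_sumr.
rewrite exchange_big /= big1 // => j _.
have [a0|a0] := eqVneq (alpha j) 0.
  rewrite big1 // => t _.
  have -> : alpha j ^+ (2 * k - (t + i)) = 0.
    by apply/eqP; rewrite a0 expf_eq0 eqxx andbT; have := ltn_ord t; lia.
  by rewrite mulr0 mul0r mulr0.
have /rootP := rh j a0; rewrite (horner_coef_wide _ szh) => hr.
transitivity (l j * alpha j ^+ (2 * k - i) * beta j ^+ i *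
              \sum_(t < n.+1) h`_t * (beta j / alpha j) ^+ t); last by rewrite hr mulr0.
rewrite mulr_sumr; apply: eq_bigr => t _.
have -> : (2 * k - i = (2 * k - (t + i)) + t)%N by have := le_tik t; lia.
rewrite expr_div_n !exprD.
by field; rewrite expf_neq0.
Qed.

Lemma power_sum_rep_flambda_ge {R : rcfType} (k s : nat) (lam : R) :
  (3 <= k)%N -> lam != 0 -> power_sum_rep (2 * k) (flambda k lam) s ->
  (2 * k - 2 <= s)%N.
Proof.
move=> k3 lam0 /power_sum_repP [|l [alpha [beta mom]]]; first by lia.
rewrite leqNgt; apply/negP => sk.
pose P := [pred j | alpha j != 0].
pose T := undup [seq beta j / alpha j | j <- enum P].
pose n := size T; pose h := \prod_(t <- T) ('X - t%:P).
have szh : size h = n.+1 by rewrite size_prod_XsubC.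
have uT : uniq T by apply: undup_uniq.
have hn : h`_n = 1.
  by have /monicP := monic_prod_XsubC T xpredT id; rewrite lead_coefE szh.
have le_ns : (n <= #|P|)%N by rewrite cardE -(size_map (fun j => beta j / alpha j)) size_undup.
have Ps : (#|P| <= s)%N by rewrite -[s in (_ <= s)%N]card_ord max_card.
have orth i : (n + i < 2 * k)%N ->
    \sum_(t < n.+1) h`_t * moment k lam (t + i) = 0.
  move=> nik; apply: apolar_moments mom _ nik _; first by rewrite szh.
  move=> j a0; rewrite root_prod_XsubC mem_undup.
  by apply/mapP; exists j; rewrite // mem_enum.
(* The indices [t + i] lie strictly between 0 and [2 * k], where only the moment at [k] is nonzero;
   this isolates one coefficient of [h]. *)
have hk i : (0 < i <= k)%N -> (k - i <= n)%N -> (n + i < 2 * k)%N -> h`_(k - i) = 0.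
  move=> /andP[i0 ik] kin nik.
  have := orth i nik.
  have lt_kin : (k - i < n.+1)%N by [].
  rewrite (bigD1 (Ordinal lt_kin)) //= subnK // big1.
    rewrite addr0 /moment eqxx mulr1 => /eqP.
    have [-> ->] : (k == 0)%N = false /\ (k == 2 * k)%N = false by split; apply/eqP; lia.
    by rewrite add0r addr0 mulf_eq0 (negPf lam0) orbF => /eqP.
  move=> t; rewrite -val_eqE /= => tki; have := ltn_ord t => tn.
  rewrite /moment; have -> : (t + i == 0)%N = false by apply/eqP; lia.
  have -> : (t + i == k)%N = false by apply/eqP; move/eqP: tki; lia.
  have -> : (t + i == 2 * k)%N = false by apply/eqP; lia.
  by rewrite mulr0 !add0r mulr0.
(* For [n < k], the choice [i = k - n] would kill the leading coefficient. *)
have [nk|kn] := ltnP n k.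
  have := hk (k - n)%N; rewrite subKn ?(ltnW nk) // hn => H.
  suff : (1 : R) = 0 by apply/eqP; rewrite oner_eq0.
  by apply: H; lia.
have srh : simple_real_rooted h.
  by exists T; split=> //; apply/allP => z; rewrite root_prod_XsubC.
(* Since [n <= 2 * k - 3], both [i = 2] and [i = 1] are admissible in [hk]. *)
apply: (simple_real_rooted_nogap h (k - 2) _ srh).
- by rewrite szh; lia.
- by apply: hk; lia.
- by rewrite (_ : (k - 2).+1 = k - 1)%N; [apply: hk; lia|lia].
Qed.

(** * The upper bound *)

Lemma horner_pos_near0 {R : realFieldType} (ps : seq {poly R}) :
  (forall p, p \in ps -> 0 < p.[0]) ->
  exists2 d : R, 0 < d &
    forall x p, p \in ps -> 0 <= x <= d -> 0 < p.[x].
Proof.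
elim: ps => [|p ps IH] ps0; first by exists 1.
have [|d d0 dP] := IH; first by move=> q qps; apply: ps0; rewrite inE qps orbT.
have p0 : 0 < p.[0] by apply: ps0; rewrite inE eqxx.
have [M MP] := poly_itv_bound (drop_poly 1 p) 0 1.
have M0 : 0 <= M by apply: le_trans (MP 0 _); rewrite ?normr_ge0 // lexx ler01.
have pE x : p.[x] = p.[0] + (drop_poly 1 p).[x] * x.
  rewrite -{1}(poly_take_drop 1 p) !hornerE; congr (_ + _ * _).
  by rewrite horner_coef0 (size1_polyC (size_take_poly 1 p)) hornerC coef_take_poly.
(* The denominator is positive even for [M = 0], and [x <= d'] forces [M * x < p.[0]]. *)
pose d' := Num.min 1 (p.[0] / (2 * (M + 1))).
have d'0 : 0 < d' by rewrite /d' lt_min ltr01 divr_gt0 //; lra.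
exists (Num.min d d') => [|x q]; first by rewrite lt_min d0 d'0.
rewrite inE => /orP[/eqP ->|qps] /andP[x0]; last first.
  by rewrite le_min => /andP[xd _]; apply: dP; rewrite // x0.
rewrite !le_min ler_pdivlMr; last by lra.
case/and3P=> _ x1 xM; rewrite pE.
have /MP : 0 <= x <= 1 by rewrite x0.
rewrite ler_norml => /andP[dM _].
have : - M * x <= (drop_poly 1 p).[x] * x by apply: ler_wpM2r.
by nra.
Qed.

(** * Coefficients of a monic polynomial given by its roots *)

Definition root_poly {R : nzRingType} (rs : seq R) : {poly R} :=
  \prod_(r <- rs) ('X - r%:P).

Lemma coef_root_poly_cons {R : comNzRingType} (r : R) (rs : seq R) (j : nat) :
  (root_poly (r :: rs))`_j.+1 = (root_poly rs)`_j - r * (root_poly rs)`_j.+1.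
Proof. by rewrite /root_poly big_cons mulrBl coefB coefXM coefCM. Qed.

Lemma coef0_root_poly_cons {R : comNzRingType} (r : R) (rs : seq R) :
  (root_poly (r :: rs))`_0 = - r * (root_poly rs)`_0.
Proof. by rewrite /root_poly big_cons mulrBl coefB coefXM coefCM sub0r mulNr. Qed.

Lemma size_root_poly {R : nzRingType} (rs : seq R) :
  size (root_poly rs) = (size rs).+1.
Proof. exact: size_prod_XsubC. Qed.

Lemma lead_root_poly {R : nzRingType} (rs : seq R) : (root_poly rs)`_(size rs) = 1.
Proof.
by have /monicP := monic_prod_XsubC rs xpredT id; rewrite lead_coefE size_root_poly.
Qed.

(** With h the polynomial of [rs] and n its degree, the scaled roots belong to [rho^-n h(rho X)]. *)
Lemma coef_root_poly_scale {R : fieldType} (rho : R) (rs : seq R) (j : nat) :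
  rho != 0 ->
  rho ^+ size rs * (root_poly [seq r / rho | r <- rs])`_j
    = rho ^+ j * (root_poly rs)`_j.
Proof.
move=> rho0; elim: rs j => [|r rs IH] j /=.
  by rewrite /root_poly !big_nil !coef1; case: j => [|j]; rewrite ?mulr0 //= expr0.
case: j => [|j]; rewrite ?coef_root_poly_cons ?coef0_root_poly_cons.
  rewrite expr0 mul1r; have := IH 0; rewrite expr0 mul1r => <-.
  by rewrite exprS; field.
rewrite !exprS mulrBr -(mulrA rho (rho ^+ size rs)) IH mulrBr.
congr (_ - _); first by ring.
transitivity (r * (rho ^+ size rs * (root_poly [seq x / rho | x <- rs])`_j.+1)).
  by field.
by rewrite IH exprS; ring.
Qed.

(* Here [k = m + 3], and [sg] is to be the sign of [lam]. *)
Definition good_roots {R : rcfType} (m : nat) (sg : R) (rs : seq R) : Prop :=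
  let q := root_poly rs in
  [/\ uniq rs, size rs = (2 * m + 4)%N, 0 < q`_0 &
  [/\ sg * q`_m.+1 < 0, 0 < sg * q`_m.+2, 0 < sg * q`_m.+3 &
      forall r, r \in rs -> r < 0 \/ 0 < sg * (r * q`_m.+3 - q`_m.+2)]].

(** Here q is X^4 + 9X^3 + X^2 - 81X + 70, and both positive roots exceed q_2 / q_3 = 1/9. *)
Lemma good_roots_base1 {R : rcfType} : good_roots 0 (1 : R) [:: 1; 2; -5; -7].
Proof.
rewrite /good_roots /=; split => //.
- by rewrite /= !inE !negb_or; do !(apply/andP; split => //); apply/eqP; lra.
- rewrite !coef0_root_poly_cons /root_poly big_nil coef1 /=; lra.
have q1 : (root_poly [:: 1; 2; -5; -7 : R])`_1 = - 81.
  rewrite !(coef0_root_poly_cons, coef_root_poly_cons) /root_poly big_nil !coef1 /=; ring.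
have q2 : (root_poly [:: 1; 2; -5; -7 : R])`_2 = 1.
  rewrite !(coef0_root_poly_cons, coef_root_poly_cons) /root_poly big_nil !coef1 /=; ring.
have q3 : (root_poly [:: 1; 2; -5; -7 : R])`_3 = 9.
  rewrite !(coef0_root_poly_cons, coef_root_poly_cons) /root_poly big_nil !coef1 /=; ring.
rewrite q1 q2 q3; split; [lra|lra|lra|].
move=> r; rewrite !inE => /or4P[] /eqP ->; [right|right|left|left]; lra.
Qed.

Lemma good_roots_baseN1 {R : rcfType} : good_roots 0 (-1 : R) [:: 8; 4; -2; -1].
Proof.
rewrite /good_roots /=; split => //.
- by rewrite /= !inE !negb_or; do !(apply/andP; split => //); apply/eqP; lra.
- rewrite !coef0_root_poly_cons /root_poly big_nil coef1 /=; lra.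
have q1 : (root_poly [:: 8; 4; -2; -1 : R])`_1 = 72.
  rewrite !(coef0_root_poly_cons, coef_root_poly_cons) /root_poly big_nil !coef1 /=; ring.
have q2 : (root_poly [:: 8; 4; -2; -1 : R])`_2 = -2.
  rewrite !(coef0_root_poly_cons, coef_root_poly_cons) /root_poly big_nil !coef1 /=; ring.
have q3 : (root_poly [:: 8; 4; -2; -1 : R])`_3 = -9.
  rewrite !(coef0_root_poly_cons, coef_root_poly_cons) /root_poly big_nil !coef1 /=; ring.
rewrite q1 q2 q3; split; [lra|lra|lra|].
move=> r; rewrite !inE => /or4P[] /eqP ->; [right|right|left|left]; lra.
Qed.

(* The new coefficients, multiplied by [e], are polynomials in [e] whose values
   at [0] are the old coefficients shifted by one, so every strict condition
   persists for small [e]. *)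
Lemma good_roots_step {R : rcfType} (m : nat) (sg : R) (rs : seq R) :
  good_roots m sg rs -> exists rs', good_roots m.+1 sg rs'.
Proof.
case=> urs szrs q0 [q1 q2 q3 rP]; set q := root_poly rs in q0 q1 q2 q3 rP.
(* [(A j).[e]] is the coefficient of degree [j.+2] in e (X + e)(X + 1/e) q = (e X^2 + (1 + e^2) X +
   e) q. *)
have [A AE] : exists A : nat -> {poly R}, forall j x,
    (A j).[x] = q`_j * x + q`_j.+1 * (1 + x ^+ 2) + q`_j.+2 * x.
  exists (fun j => q`_j *: 'X + q`_j.+1 *: (1 + 'X^2) + q`_j.+2 *: 'X) => j x.
  by rewrite !hornerE.
(* In order: the three coefficient signs, [- e] distinct from [- e^-1], neither of them already in
   [rs], and the nonnegative roots staying beyond the new ratio. *)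
pose ps := [:: - (sg *: A m); sg *: A m.+1; sg *: A m.+2; 1 - 'X]
  ++ [seq `|r|%:P - 'X | r <- rs] ++ [seq 1 + r *: 'X | r <- rs]
  ++ [seq sg *: (r *: A m.+2 - A m.+1) | r <- rs & ~~ (r < 0)].
have [|e e0 eP] := horner_pos_near0 ps.
  move=> p; rewrite !mem_cat !inE => /orP[/or4P[]/eqP ->|/or3P[]].
  - by rewrite !hornerE AE; nra.
  - by rewrite !hornerE AE; nra.
  - by rewrite !hornerE AE; nra.
  - by rewrite !hornerE; lra.
  - case/mapP=> r rrs ->; rewrite !hornerE subr0 normr_gt0.
    apply: contraTneq (q0) => r0; rewrite -horner_coef0.
    have : root q 0 by rewrite root_prod_XsubC -r0.
    by move/rootP ->; rewrite ltxx.
  - by case/mapP=> r rrs ->; rewrite !hornerE; lra.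
  - case/mapP=> r; rewrite mem_filter => /andP[/negP rn rrs] ->.
    by case: (rP r rrs) => // h; rewrite !hornerE !AE; nra.
have {}eP p : p \in ps -> 0 < p.[e].
  by move=> pps; apply: eP pps _; rewrite (ltW e0) lexx.
have e_neq0 : e != 0 by rewrite gt_eqF.
have A1 : 0 < - (sg * (A m).[e]).
  by have := eP (- (sg *: A m)); rewrite !hornerE /ps !inE eqxx; apply.
have A2 : 0 < sg * (A m.+1).[e].
  by have := eP (sg *: A m.+1); rewrite hornerZ /ps !inE eqxx !orbT; apply.
have A3 : 0 < sg * (A m.+2).[e].
  by have := eP (sg *: A m.+2); rewrite hornerZ /ps !inE eqxx !orbT; apply.
have e1 : e < 1.
  by have := eP (1 - 'X); rewrite !hornerE /ps !inE eqxx !orbT => /(_ isT); lra.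
have re r : r \in rs -> e < `|r|.
  move=> rrs; have := eP (`|r|%:P - 'X); rewrite !hornerE /ps !mem_cat.
  by rewrite (map_f (fun r => `|r|%:P - 'X)) // orbT => /(_ isT); lra.
have rV r : r \in rs -> 0 < 1 + r * e.
  move=> rrs; have := eP (1 + r *: 'X); rewrite !hornerE /ps !mem_cat.
  by rewrite (map_f (fun r => 1 + r *: 'X)) // !orbT; apply.
have rA r : r \in rs -> ~~ (r < 0) -> 0 < sg * (r * (A m.+2).[e] - (A m.+1).[e]).
  move=> rrs rn; have := eP (sg *: (r *: A m.+2 - A m.+1)); rewrite !hornerE /ps !mem_cat.
  rewrite (map_f (fun r => sg *: (r *: A m.+2 - A m.+1))) ?mem_filter ?rn // !orbT.
  by apply.
pose rs' := [:: - e, - e^-1 & rs].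
have q'E j : e * (root_poly rs')`_j.+2 = (A j).[e].
  rewrite !coef_root_poly_cons -/q AE; by field.
have sgE j : sg * (root_poly rs')`_j.+2 = e^-1 * (sg * (A j).[e]).
  by rewrite -q'E; field.
have ei : 0 < e^-1 by rewrite invr_gt0.
exists rs'; split.
- rewrite /= urs inE negb_or andbT -!andbA; apply/and3P; split.
  + rewrite eqr_opp; apply/negP => /eqP ee.
    have e2 : e * e = 1 by rewrite {2}ee mulfV.
    by move: (e1); rewrite -[X in _ < X]e2 ltr_pMr // ltNge (ltW e1).
  + by apply/negP => /re; rewrite normrN gtr0_norm // ltxx.
  + by apply/negP => /rV; rewrite mulNr mulVf // subrr ltxx.
- by rewrite /= szrs mulnS.
- rewrite !coef0_root_poly_cons -/q.
  by rewrite !opprK mulrA mulfV // mul1r.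
split.
- by rewrite sgE pmulr_rlt0 // -oppr_gt0.
- by rewrite sgE pmulr_rgt0.
- by rewrite sgE pmulr_rgt0.
move=> r; rewrite !inE => /or3P[/eqP->|/eqP->|rrs]; try by left; rewrite oppr_lt0.
have [rn|rn] := boolP (r < 0); [by left|right].
rewrite -(pmulr_rgt0 _ e0).
have -> : e * (sg * (r * (root_poly rs')`_m.+4 - (root_poly rs')`_m.+3)) =
  sg * (r * (A m.+2).[e] - (A m.+1).[e]) by rewrite -!q'E; ring.
exact: rA.
Qed.

Lemma good_roots_exist {R : rcfType} (m : nat) (lam : R) : lam != 0 ->
  exists (sg : R) (rs : seq R), 0 < sg * lam /\ good_roots m sg rs.
Proof.
move=> lam0.
have [sg [sgl [rs0 g0]]] : exists sg : R, 0 < sg * lam /\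
    exists rs, good_roots 0 sg rs.
  have [l|l] := ltP 0 lam.
    by exists 1; rewrite mul1r; split=> //; exists [:: 1; 2; -5; -7]; exact: good_roots_base1.
  exists (-1); rewrite mulN1r oppr_gt0 lt_neqAle lam0 l; split=> //.
  by exists [:: 8; 4; -2; -1]; exact: good_roots_baseN1.
suff [rs gm] : exists rs, good_roots m sg rs by exists sg, rs.
elim: m => [|m [rs gm]]; first by exists rs0.
exact: good_roots_step gm.
Qed.

(** * Positive n-th roots, and power sums with prescribed slopes *)

Lemma exists_root_pos {R : rcfType} (n : nat) (c : R) : (0 < n)%N -> 0 < c ->
  exists2 x, 0 < x & x ^+ n = c.
Proof.
move=> n0 c0.
have [||x /andP[x0 _] /rootP] := poly_ivt (p := 'X^n - c%:P) (a := 0) (b := 1 + c).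
- lra.
- rewrite !hornerE expr0n eqn0Ngt n0 sub0r oppr_le0 (ltW c0) /= subr_ge0.
  by apply: le_trans (ler_eXnr n0 _); lra.
rewrite !hornerE => /eqP; rewrite subr_eq0 => /eqP xc; exists x => //.
rewrite lt_neqAle x0 andbT; apply: contraTneq c0 => x_eq0.
by rewrite -xc -x_eq0 expr0n eqn0Ngt n0 ltxx.
Qed.

Lemma moment_weights {R : fieldType} (ts : seq R) (a : nat -> R) : uniq ts ->
  exists l : 'I_(size ts) -> R, forall m, (m < size ts)%N ->
    \sum_(j < size ts) l j * ts`_j ^+ m = a m.
Proof.
move=> uts; pose n := size ts.
pose V := Vandermonde n (\row_(j < n) ts`_j).
have Vu : V \in unitmx.
  rewrite unitmxE unitfE det_Vandermonde; apply/prodf_neq0 => i _.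
  apply/prodf_neq0 => j ij; rewrite !mxE subr_eq0 nth_uniq //.
  by rewrite gtn_eqF.
pose w := invmx V *m \col_(i < n) a i.
exists (fun j => w j 0) => m mn.
have /(congr1 (fun M : 'cV_n => M (Ordinal mn) 0)) : V *m w = \col_(i < n) a i by rewrite mulKVmx.
by rewrite !mxE => <-; apply: eq_bigr => j _; rewrite !mxE mulrC.
Qed.

(** Vandermonde weights match the moments of index below [2 * k - 1]. The last two follow from the
    linear recurrence with characteristic polynomial [root_poly ts]: the first coefficient condition
    makes moment [2 * k - 1] vanish, the second makes moment [2 * k] equal 1. *)
Lemma root_poly_power_sum {R : numFieldType} (k : nat) (lam : R) (ts : seq R) :
  (1 < k)%N -> uniq ts -> size ts = (2 * k - 1)%N ->
  (root_poly ts)`_0 = - lam * (root_poly ts)`_k ->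
  lam * (root_poly ts)`_k.-1 = -1 ->
  power_sum_rep (2 * k) (flambda k lam) (size ts).
Proof.
move=> k1 uts szt h0 hk.
have [l lP] := moment_weights ts (moment k lam) uts.
apply/power_sum_repP; first by lia.
exists l, (fun=> 1), (fun j => ts`_j) => m mk.
pose M i := \sum_(j < size ts) l j * ts`_j ^+ i.
transitivity (M m).
  by apply: eq_bigr => j _; rewrite expr1n mulr1.
have rec i : \sum_(t < size ts) (root_poly ts)`_t * M (t + i)%N
    + M (size ts + i)%N = 0.
  transitivity (\sum_(t < (size ts).+1) (root_poly ts)`_t * M (t + i)%N).
    by rewrite big_ord_recr /= lead_root_poly mul1r.
  under eq_bigr do rewrite mulr_sumr.
  rewrite exchange_big big1 //= => j _.
  have /rootP : root (root_poly ts) ts`_j by rewrite root_prod_XsubC mem_nth.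
  rewrite (horner_coef_wide _ (n := (size ts).+1)) ?size_root_poly // => hj.
  transitivity (l j * ts`_j ^+ i *
    \sum_(t < (size ts).+1) (root_poly ts)`_t * ts`_j ^+ t); last by rewrite hj mulr0.
  rewrite mulr_sumr; apply: eq_bigr => t _; rewrite exprD.
  by ring.
have pick (h : nat -> R) j : (j < size ts)%N ->
    \sum_(t < size ts) h t * (t == j :> nat)%:R = h j.
  move=> js; rewrite (bigD1 (Ordinal js)) //= eqxx mulr1 big1 ?addr0 // => t.
  by rewrite -val_eqE /= => /negPf ->; rewrite mulr0.
have lt_t (t : 'I_(size ts)) : (t < 2 * k - 1)%N.
  by have := ltn_ord t; rewrite [X in (_ < X)%N]szt.
have M1 : M (2 * k - 1)%N = 0.
  have := rec 0; rewrite addn0 szt => /eqP; rewrite addrC addr_eq0 => /eqP ->.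
  rewrite -szt; apply/eqP; rewrite oppr_eq0; apply/eqP.
  transitivity (\sum_(t < size ts) ((root_poly ts)`_t * (t == 0 :> nat)%:R
      + lam * (root_poly ts)`_t * (t == k :> nat)%:R)).
    apply: eq_bigr => t _; rewrite addn0 /M lP // /moment.
    have -> : (t == 2 * k :> nat)%N = false.
      by apply/eqP; have := lt_t t; lia.
    by rewrite addr0; ring.
  rewrite big_split /= (pick (fun t => (root_poly ts)`_t)) ?szt; last by lia.
  rewrite -szt (pick (fun t => lam * (root_poly ts)`_t)) ?szt ?h0; [ring|lia].
have M2 : M (2 * k)%N = 1.
  have := rec 1; rewrite szt (_ : 2 * k - 1 + 1 = 2 * k)%N; last by lia.
  rewrite addrC => /eqP; rewrite addr_eq0 => /eqP ->.
  rewrite -[RHS]opprK -hk -szt; congr (- _).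
  rewrite -(pick (fun t => lam * (root_poly ts)`_t)) ?szt; last by lia.
  rewrite -szt; apply: eq_bigr => t _; rewrite addn1.
  have tk : (t == k.-1 :> nat) = (t.+1 == k) by rewrite -[k in RHS]prednK //; lia.
  (* Only the index [t.+1 = size ts] is out of reach of [lP]; [M1] covers it. *)
  have [ts1|ts1] := eqVneq t.+1 (size ts).
    have -> : M t.+1 = 0 by rewrite ts1 szt.
    have -> : (t == k.-1 :> nat) = false by rewrite tk ts1; apply/eqP; lia.
    by rewrite !mulr0.
  rewrite /M lP; last by rewrite ltn_neqAle ts1 ltn_ord.
  rewrite /moment tk.
  have -> : (t.+1 == 2 * k)%N = false.
    by apply/eqP; have := lt_t t; lia.
  by rewrite /= add0r addr0; ring.
have [mlt|] := ltnP m (size ts); first exact: lP.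
rewrite leq_eqVlt szt => /orP[/eqP <-|mgt].
  rewrite M1 /moment; have [-> ->] : (2 * k - 1 == 0)%N = false /\ (2 * k - 1 == k)%N = false.
    by split; apply/eqP; lia.
  have -> : (2 * k - 1 == 2 * k)%N = false by apply/eqP; lia.
  by rewrite mulr0 !addr0.
have -> : m = (2 * k)%N by lia.
rewrite M2 /moment eqxx.
have [-> ->] : (2 * k == 0)%N = false /\ (2 * k == k)%N = false by split; apply/eqP; lia.
by rewrite mulr0 !add0r.
Qed.

(* The scaling [t -> rho t], with [rho ^ k = - h_0 / (lam h_k)], turns these
   conditions on [h] into apolarity to [flambda]. *)
Lemma exists_balanced_roots {R : rcfType} (m : nat) (lam : R) : lam != 0 ->
  exists us : seq R, let h := root_poly us in
  [/\ uniq us, size us = (2 * m + 5)%N, h`_m.+3 != 0,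
      lam ^+ 2 * (h`_m.+3 * h`_m.+2) = h`_0 & 0 < - h`_0 / (lam * h`_m.+3)].
Proof.
move=> lam0.
have [sg [rs [sgl [urs szrs q0 [q1 q2 q3 rP]]]]] := good_roots_exist m lam lam0.
set q := root_poly rs in q0 q1 q2 q3 rP.
have sg_neq0 : sg != 0 by apply: contraTneq sgl => ->; rewrite mul0r ltxx.
have sg2 : 0 < sg ^+ 2 by rewrite exprn_even_gt0.
have q3_neq0 : q`_m.+3 != 0 by apply: contraTneq q3 => ->; rewrite mulr0 ltxx.
have s1_gt0 : 0 < q`_m.+2 / q`_m.+3.
  have -> : q`_m.+2 / q`_m.+3 = (sg * q`_m.+2) * (sg * q`_m.+3) / (sg ^+ 2 * q`_m.+3 ^+ 2).
    by field; rewrite q3_neq0.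
  have q32 : 0 < q`_m.+3 ^+ 2 by rewrite exprn_even_gt0.
  by apply: divr_gt0; apply: mulr_gt0.
set s1 := q`_m.+2 / q`_m.+3 in s1_gt0.
have s1E : s1 * q`_m.+3 = q`_m.+2 by rewrite /s1 divfK.
(* The condition [lam^2 c_k c_(k-1) = c_0 c_(2k-1)] for [(X - s) q]. *)
pose F : {poly R} := lam ^+ 2 *: (((q`_m.+2)%:P - q`_m.+3 *: 'X)
                                  * ((q`_m.+1)%:P - q`_m.+2 *: 'X)) + q`_0 *: 'X.
have FE s : F.[s] = lam ^+ 2 * ((q`_m.+2 - q`_m.+3 * s) * (q`_m.+1 - q`_m.+2 * s)) + q`_0 * s.
  by rewrite /F !hornerE.
(* At 0 the sign comes from q_(k-2) q_(k-1) < 0; at [s1] the first factor vanishes and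
   [q_0 * s1 > 0] remains. *)
have F0 : F.[0] < 0.
  rewrite FE !mulr0 !subr0 addr0 pmulr_rlt0 ?exprn_even_gt0 //.
  by rewrite -(pmulr_rlt0 _ sg2) expr2 mulrACA pmulr_rlt0.
have F1 : 0 < F.[s1].
  by rewrite FE (mulrC _ s1) s1E subrr mul0r mulr0 add0r mulr_gt0.
have [|s /andP[s0 ss1] /rootP Fs] := poly_ivt (p := F) (ltW s1_gt0).
  by rewrite (ltW F0) (ltW F1).
have {}s0 : 0 < s.
  rewrite lt_neqAle s0 andbT; apply: contraTneq F0 => s_eq0.
  by rewrite [X in F.[X]]s_eq0 Fs ltxx.
have {}ss1 : s < s1.
  rewrite lt_neqAle ss1 andbT; apply: contraTneq F1 => s_eq1.
  by rewrite -[X in F.[X]]s_eq1 Fs ltxx.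
pose us := s :: rs; pose h := root_poly us.
(* Each root of [q] is negative or exceeds [s1], so [s] is a new root. *)
have uus : uniq us.
  rewrite /= urs andbT; apply/negP => /rP[|]; first by rewrite ltNge (ltW s0).
  rewrite -s1E -mulrBl mulrCA nmulr_rgt0 ?subr_lt0 //.
  by rewrite ltNge (ltW q3).
have h0E : h`_0 = - s * q`_0 by rewrite /h coef0_root_poly_cons.
have h2E : h`_m.+2 = q`_m.+1 - s * q`_m.+2 by rewrite /h coef_root_poly_cons.
have h3E : h`_m.+3 = q`_m.+2 - s * q`_m.+3 by rewrite /h coef_root_poly_cons.
have sgh3 : 0 < sg * h`_m.+3.
  by rewrite h3E -s1E -mulrBl mulrCA mulr_gt0 // subr_gt0.
have h3_neq0 : h`_m.+3 != 0 by apply: contraTneq sgh3 => ->; rewrite mulr0 ltxx.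
have hF : lam ^+ 2 * (h`_m.+3 * h`_m.+2) = h`_0.
  by move: Fs; rewrite FE h0E h2E h3E => Fs; lra.
have c_gt0 : 0 < - h`_0 / (lam * h`_m.+3).
  have -> : - h`_0 / (lam * h`_m.+3)
      = s * q`_0 * sg ^+ 2 / ((sg * lam) * (sg * h`_m.+3)).
    by rewrite h0E; field; rewrite sg_neq0 lam0 h3_neq0.
  by apply: divr_gt0; apply: mulr_gt0 => //; apply: mulr_gt0.
by exists us; split => //; rewrite /= szrs -addnS.
Qed.

Lemma power_sum_rep_flambda {R : rcfType} (k : nat) (lam : R) :
  (3 <= k)%N -> lam != 0 -> power_sum_rep (2 * k) (flambda k lam) (2 * k - 1).
Proof.
move=> k3 lam0; have [m kE] : exists m, k = m.+3 by exists (k - 3)%N; lia.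
have [us [uus szus h3_neq0 hF c_gt0]] := exists_balanced_roots m lam lam0.
set h := root_poly us in h3_neq0 hF c_gt0.
have k0 : (0 < k)%N by lia.
have [rho rho0 rhoE] := exists_root_pos k _ k0 c_gt0.
have rho_neq0 : rho != 0 by rewrite gt_eqF.
pose ts := [seq r / rho | r <- us].
have szts : size ts = (2 * k - 1)%N by rewrite /ts size_map szus; lia.
have hs j : rho ^+ size us * (root_poly ts)`_j = rho ^+ j * h`_j.
  exact: coef_root_poly_scale.
have rhon : rho ^+ size us != 0 by rewrite expf_neq0.
rewrite -szts; apply: root_poly_power_sum => //; first by lia.
- by rewrite map_inj_uniq // => x y /divIf; apply.
- apply: (mulfI rhon); rewrite hs mulrCA hs rhoE kE expr0 mul1r.
  by field; rewrite lam0 h3_neq0.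
- apply: (mulfI rhon); rewrite mulrCA hs kE /=.
  (* Splitting the degree as k + (k - 1) brings out [rho ^+ k], after which [hF] gives the value
     -1. *)
  have -> : size us = (m.+3 + m.+2)%N by rewrite szus; lia.
  rewrite exprD -kE rhoE -hF.
  by field; rewrite lam0 h3_neq0.
Qed.

(** * The two possible values of the real rank *)

Theorem theorem3p5 (R : realType) (k : nat) (lambda : R)
    (hk : (3 <= k)%N) (hlambda : lambda <> 0) :
  exists r : nat,
    is_rank (2 * k) (flambda k lambda) r /\
    (r = (2 * k - 2)%N \/ r = (2 * k - 1)%N).
Proof.
have lam0 : lambda != 0 by apply/eqP.
have ge s := power_sum_rep_flambda_ge k s lambda hk lam0.
have rep := power_sum_rep_flambda k lambda hk lam0.
have [rep2|nrep2] := boolp.EM (power_sum_rep (2 * k) (flambda k lambda) (2 * k - 2)).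
  by exists (2 * k - 2)%N; split; [split|left].
exists (2 * k - 1)%N; split; last by right.
split=> // s reps; have := ge s reps; rewrite leq_eqVlt => /orP[/eqP sE|]; last by lia.
by case: nrep2; rewrite sE.
Qed.
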